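(* For every $k\ge1$ there are bijections $$\mathcal T_{\infty,2}(k)\leftrightarrow\mathcal{MP}(k),\qquad\mathcal T_{2,2}(k)\leftrightarrow\mathcal{RMP}(k).$$
   Context: \textbf{Decorated trees.} In a rooted planar tree, a node is a leaf if it has no children and internal otherwise; an angle is the sector between two consecutive children of an internal node. $\mathcal T_{\infty,2}$ is the set of finite rooted planar trees with at least one internal node, with each angle labeled by a positive integer and each internal node labeled by $0$ or $1$, such that: every internal node has at least two children; among the children of each node only the leftmost and rightmost can be leaves; only the root may have label $0$ (all other internal nodes have label $1$). $\mathcal T_{2,2}\subseteq\mathcal T_{\infty,2}$ is the subset of trees all of whose angle labels are $1$. $\deg_{\mathrm{node}}(t)$ is the sum of the internal node labels of $t$ and $\deg_{\mathrm{angle}}(t)$ the sum of its angle labels. For $i\in\{2,\infty\}$, $\mathcal T_{i,2}(k)$ is the set of $t\in\mathcal T_{i,2}$ with $\deg_{\mathrm{angle}}(t)+\deg_{\mathrm{node}}(t)=k$. \textbf{Motzkin paths.} $\mathcal{MP}(k)$ is the set of Motzkin paths of length $k$: lattice paths from $(0,0)$ to $(k,0)$ with steps $U=(1,1)$, $H=(1,0)$, $D=(1,-1)$, never crossing below the $x$-axis. $\mathcal{RMP}(k)$ is the subset of paths in $\mathcal{MP}(k)$ in which each horizontal step is followed by an up step, except if it is the last step. *)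

(* Defs.v *)
From mathcomp Require Import all_boot all_order all_algebra.

Set Implicit Arguments.
Unset Strict Implicit.
Unset Printing Implicit Defensive.

Import Order.TTheory GRing.Theory Num.Theory.

(** * Decorated trees *)

(* [Node l a ts] is an internal node with label [l] and children [ts] from
   left to right; the i-th entry of [a] labels the angle between the i-th and
   the (i+1)-st child.  That [a] has the right length, and that [ts] is not
   empty, is imposed by [is_tree] below. *)
Inductive tree : Type :=
| Leaf
| Node of nat & seq nat & seq tree.

Definition is_leaf (t : tree) : bool := if t is Leaf then true else false.

(* Preorder enumeration: when [t] is not a leaf, the head is the root label. *)
Fixpoint node_labels (t : tree) : seq nat :=
  if t is Node l _ ts then l :: flatten (map node_labels ts) else [::].

Fixpoint angle_labels (t : tree) : seq nat :=
  if t is Node _ a ts then a ++ flatten (map angle_labels ts) else [::].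

Definition deg_node (t : tree) : nat := sumn (node_labels t).
Definition deg_angle (t : tree) : nat := sumn (angle_labels t).

Definition only_outer_leaves (ts : seq tree) : bool :=
  all (fun i => is_leaf (nth Leaf ts i) ==> (i == 0) || (i == (size ts).-1))
      (iota 0 (size ts)).

Fixpoint is_tree (t : tree) : bool :=
  if t is Node _ a ts then
    [&& size ts == (size a).+1, 2 <= size ts, only_outer_leaves ts
      & all is_tree ts]
  else true.

Definition in_T_inf_2 (t : tree) : bool :=
  [&& ~~ is_leaf t,
      is_tree t,
      all (fun n => 0 < n) (angle_labels t),
      all (fun l => (l == 0) || (l == 1)) (node_labels t)
    & all (fun l => l == 1) (behead (node_labels t))].

Definition in_T_2_2 (t : tree) : bool :=
  in_T_inf_2 t && all (fun n => n == 1) (angle_labels t).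

Definition T_inf_2 (k : nat) : Type :=
  {t : tree | in_T_inf_2 t && (deg_angle t + deg_node t == k)}.

Definition T_2_2 (k : nat) : Type :=
  {t : tree | in_T_2_2 t && (deg_angle t + deg_node t == k)}.

(** * Motzkin paths *)

Inductive step : Type := U | H | D.

Definition is_up (s : step) : bool := if s is U then true else false.
Definition is_horizontal (s : step) : bool := if s is H then true else false.

Local Open Scope ring_scope.

Definition step_vec (s : step) : int * int :=
  match s with
  | U => (1, 1)
  | H => (1, 0)
  | D => (1, -1)
  end.

Definition endpoint (p : seq step) : int * int := \sum_(s <- p) step_vec s.

Definition is_motzkin (k : nat) (p : seq step) : bool :=
  (endpoint p == (k%:Z, 0)) &&
  all (fun n => 0 <= (endpoint (take n p)).2) (iota 0 (size p).+1).

(* [sorted r p] says that [r] holds for every two consecutive entries of [p],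
   so nothing is required of the last step. *)
Definition is_restricted (p : seq step) : bool :=
  sorted (fun s s' => is_horizontal s ==> is_up s') p.

Definition MP (k : nat) : Type := {p : seq step | is_motzkin k p}.

Definition RMP (k : nat) : Type :=
  {p : seq step | is_motzkin k p && is_restricted p}.

(* Main.v *)
Require Import Defs.
From mathcomp Require Import all_boot.
From mathcomp Require Import all_order all_algebra zify.

Set Implicit Arguments.
Unset Strict Implicit.
Unset Printing Implicit Defensive.

(** Trees and paths satisfy the same quadratic equation, and that equation can
    be solved by the same binary structure on both sides.  Let [x] mark the
    length of a path or the degree of a tree, and put a := x / (1 - x), the
    series of a positive angle label.

    Paths.  A nonempty Motzkin path is either flat, H^m with m >= 1, or splits
    at its last arch as Q U E H^n D H^m with Q and E H^m Motzkin and E not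
    ending in H.  Exchanging the flat runs n and m, such a path amounts to n and
    the two Motzkin paths Q and R := E H^m, so the series M of Motzkin paths
    satisfies M = 1 + a + a x M^2.  The exchange is what makes the restricted
    paths visible: a run of flat steps before D is forbidden, so n = 0, and one
    that ends the path has at most one step, so m <= 1; hence the path is
    restricted exactly when n = 0 and both Q and R are restricted, which
    replaces a by x in the equation.

    Trees.  Add to the trees a bare leaf, of degree 0.  The root label is 0 or
    1, and a nonleaf subtree below the root is any tree whose root label has
    been set to 1.  Given an angle label and two trees q and r, relabel q to 1 and
    hang it in r: between the first and second child of r if both are nonleaf
    and r has root label 0, the root label of q being passed on to the new root;
    otherwise hang q and r, both relabelled 1, below a new root, whose label 0
    or 1 records whether a label 0 was lost.  The result has three or more
    children in the first case and two in the second, and the operation reaches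
    every tree but the bare leaf and the one-angle trees of root label 0, once
    ([split_join], [build_split]).  It adds the new angle label plus one to the
    degree, so the trees obey the same equation, and allowing only the angle
    label 1 again replaces a by x.

    The common structure is the type [code]; [word] and [tree_of_code] are the
    two translations, each injective with the expected image ([wordK],
    [word_onto], [tree_of_code_inj], [tree_of_code_onto]).  They carry the size
    of a code to length and to degree, and [thin] codes to restricted paths and
    to trees with unit angle labels. *)

(** * Codes *)

(** The solutions of M = 1 + a + a x M^2: [Flat 0] is the term 1, [Flat m.+1]
    the term a, and [Arch n q r] uses the positive integer [n.+1]. *)
Inductive code : Type :=
| Flat of nat
| Arch of nat & code & code.

Fixpoint code_size (c : code) : nat :=
  match c with
  | Flat m => m
  | Arch n q r => n + 2 + code_size q + code_size r
  end.

Fixpoint thin (c : code) : bool :=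
  match c with
  | Flat m => m <= 1
  | Arch n q r => [&& n == 0, thin q & thin r]
  end.

(** The preimages are asked for as data, so that no choice is needed to define
    the two inverse maps. *)
Lemma sub_bijective_of_common_code (X Y Z : Type) (f : Z -> X) (g : Z -> Y)
    (P : pred X) (Q : pred Y) :
  injective f -> injective g ->
  (forall x, P x -> {z | f z = x}) -> (forall y, Q y -> {z | g z = y}) ->
  (forall z, P (f z) = Q (g z)) ->
  exists h : {x | P x} -> {y | Q y}, bijective h.
Proof.
move=> f_inj g_inj f_onto g_onto PQ.
pose zf (x : {x | P x}) := f_onto _ (valP x).
pose zg (y : {y | Q y}) := g_onto _ (valP y).
have Qz x : Q (g (sval (zf x))) by rewrite -PQ (svalP (zf x)) (valP x).
have Pz y : P (f (sval (zg y))) by rewrite PQ (svalP (zg y)) (valP y).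
exists (fun x => exist (fun y => Q y) _ (Qz x));
exists (fun y => exist (fun x => P x) _ (Pz y)) => [x|y];
  apply: val_inj => /=.
  rewrite -[RHS](svalP (zf x)); congr f; apply: g_inj.
  exact: (svalP (zg (exist (fun y => Q y) _ (Qz x)))).
rewrite -[RHS](svalP (zg y)); congr g; apply: f_inj.
exact: (svalP (zf (exist (fun x => P x) _ (Pz y)))).
Qed.

(** * Motzkin paths by induction on the steps *)

Fixpoint motzkin_from (h : nat) (p : seq step) : bool :=
  match p with
  | [::] => h == 0
  | U :: p' => motzkin_from h.+1 p'
  | H :: p' => motzkin_from h p'
  | D :: p' => (0 < h) && motzkin_from h.-1 p'
  end.

Section Endpoint.
Import GRing.Theory Num.Theory.
Local Open Scope ring_scope.

Lemma endpoint_cons s p : endpoint (s :: p) = step_vec s + endpoint p.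
Proof. by rewrite /endpoint big_cons. Qed.

Lemma endpoint_length p : (endpoint p).1 = (size p)%:Z.
Proof.
elim: p => [|s p IHp]; first by rewrite /endpoint big_nil.
rewrite endpoint_cons /= IHp; case: s => /=; lia.
Qed.

(** Starting at an arbitrary height is what lets the induction go through: the
    first step only shifts the height for the remaining path. *)
Lemma motzkin_fromE h p :
  motzkin_from h p =
  (h%:Z + (endpoint p).2 == 0) &&
  all (fun n => 0 <= h%:Z + (endpoint (take n p)).2) (iota 0 (size p).+1).
Proof.
have endpoint_nil : endpoint [::] = 0 by rewrite /endpoint big_nil.
elim: p h => [|s p IHp] h.
  by rewrite /= endpoint_nil addr0; lia.
have -> : iota 0 (size (s :: p)).+1 = 0%N :: map S (iota 0 (size p).+1).
  by rewrite -(iotaDl 1 0).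
have r0 : 0%N \in iota 0 (size p).+1 by rewrite mem_iota.
move: (iota 0 _) r0 IHp => r r0 IHp.
rewrite /= endpoint_nil addr0 all_map /=.
rewrite (@eq_all _ _ (fun n =>
    0 <= h%:Z + (step_vec s).2 + (endpoint (take n p)).2)); last first.
  by move=> n /=; rewrite endpoint_cons /= addrA.
rewrite endpoint_cons /= addrA.
case: s => /=.
- by rewrite IHp -[in LHS]addn1 PoszD.
- by rewrite IHp addr0.
case: h => [|h]; last by rewrite /= IHp -addn1 PoszD addrK.
(* A step D from height 0 violates the condition right after that step. *)
case: allP => [/(_ _ r0)|]; last by rewrite andbF.
by rewrite /= take0 endpoint_nil.
Qed.

Lemma is_motzkinE k p : is_motzkin k p = (size p == k) && motzkin_from 0 p.
Proof.
rewrite /is_motzkin motzkin_fromE add0r -pair_eqE /= endpoint_length eqz_nat.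
rewrite -!andbA; do 2!congr (_ && _); rewrite add0r; congr (_ && _).
by apply: eq_all => n; rewrite add0r.
Qed.

End Endpoint.

(** * Motzkin paths and codes *)

Fixpoint final_flats (c : code) : nat :=
  match c with
  | Flat m => m
  | Arch _ _ r => final_flats r
  end.

Fixpoint set_flats (m : nat) (c : code) : code :=
  match c with
  | Flat _ => Flat m
  | Arch n q r => Arch n q (set_flats m r)
  end.

(** The word of [Arch n q r] is Q U E H^n D H^m, where Q is the word of [q] and
    the word of [r] is E H^m.  Since the final flats of [r] move behind D while
    H^n takes their place, the recursion runs on words without their final
    flats. *)
Fixpoint stem (c : code) : seq step :=
  match c with
  | Flat _ => [::]
  | Arch n q r =>
      (stem q ++ nseq (final_flats q) H) ++ U :: (stem r ++ nseq n H) ++ [:: D]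
  end.

Definition word (c : code) : seq step := stem c ++ nseq (final_flats c) H.

Lemma final_flats_set m c : final_flats (set_flats m c) = m.
Proof. by elim: c. Qed.

Lemma stem_set m c : stem (set_flats m c) = stem c.
Proof. by elim: c => //= n q _ r ->. Qed.

Lemma set_flats_set m m' c : set_flats m (set_flats m' c) = set_flats m c.
Proof. by elim: c => //= n q _ r ->. Qed.

Lemma set_flats_id c : set_flats (final_flats c) c = c.
Proof. by elim: c => //= n q _ r ->. Qed.

Lemma size_word c : size (word c) = code_size c.
Proof.
rewrite /word; elim: c => [m|n q IHq r IHr] /=; first by rewrite size_nseq.
by rewrite -IHq -IHr !(size_cat, size_nseq) /= !(size_cat, size_nseq) /=; lia.
Qed.

Lemma motzkin_from_flats h m w :
  motzkin_from h (nseq m H ++ w) = motzkin_from h w.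
Proof. by elim: m. Qed.

Lemma motzkin_from_stem h c w :
  motzkin_from h (stem c ++ w) = motzkin_from h w.
Proof.
elim: c h w => [//|n q IHq r IHr] h w /=.
by rewrite -!catA IHq motzkin_from_flats /= -!catA IHr motzkin_from_flats.
Qed.

Lemma motzkin_word c : motzkin_from 0 (word c).
Proof.
by rewrite /word motzkin_from_stem -[nseq _ _]cats0 motzkin_from_flats.
Qed.

(** [c] codes what has been read since the last unmatched U, and [stack] what
    was read before each unmatched U, the innermost first.  At a matched D the
    final flats of [c] become the label of the arch, and the new current code
    ends with no flat step. *)
Fixpoint parse (stack : seq code) (c : code) (p : seq step) : code :=
  match p with
  | [::] => c
  | U :: p' => parse (c :: stack) (Flat 0) p'
  | H :: p' => parse stack (set_flats (final_flats c).+1 c) p'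
  | D :: p' =>
      if stack is q :: stack'
      then parse stack' (Arch (final_flats c) q (set_flats 0 c)) p'
      else c
  end.

Lemma parse_flats stack c m p :
  parse stack c (nseq m H ++ p) =
  parse stack (set_flats (final_flats c + m) c) p.
Proof.
elim: m c => [|m IHm] c /=; first by rewrite addn0 set_flats_id.
by rewrite IHm final_flats_set set_flats_set addSnnS.
Qed.

Lemma parse_stem stack c m p :
  parse stack (Flat 0) ((stem c ++ nseq m H) ++ p) =
  parse stack (set_flats m c) p.
Proof.
elim: c stack m p => [m'|n q IHq r IHr] stack m p /=.
  by rewrite parse_flats.
rewrite -[((_ ++ _) ++ _) ++ p]catA -catA IHq set_flats_id /= -catA IHr /=.
by rewrite parse_flats /= !final_flats_set !set_flats_set.
Qed.

Lemma wordK : cancel word (parse [::] (Flat 0)).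
Proof.
by move=> c; rewrite -[word c]cats0 /word parse_stem set_flats_id.
Qed.

(** The invariant of the parser: the words on the stack, rejoined by the
    unmatched U's, followed by the current word and by the unread steps, always
    spell the whole path. *)
Lemma word_parse stack c p :
  motzkin_from (size stack) p ->
  word (parse stack c p) =
  foldl (fun w q => word q ++ U :: w) (word c ++ p) stack.
Proof.
elim: p stack c => [|s p IHp] stack c /=.
  by case: stack => // _; rewrite cats0.
case: s => [/(IHp (c :: stack)) -> // | /IHp -> |].
  rewrite /word final_flats_set stem_set -addn1 nseqD -!catA.
  exact.
case: stack => // q stack /= /IHp ->.
by rewrite /word /= final_flats_set stem_set cats0 -!catA /= -!catA.
Qed.

Lemma word_onto p : motzkin_from 0 p -> {c | word c = p}.
Proof.
by move=> p_motzkin; exists (parse [::] (Flat 0) p); apply: word_parse.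
Qed.

(** * Restricted paths *)

Arguments is_restricted : simpl never.

Lemma is_restricted_cons s p :
  is_restricted (s :: p) =
  (is_horizontal s ==> is_up (head U p)) && is_restricted p.
Proof. by case: p => [|s' p] //; case: s. Qed.

(** Every step may precede U and every step may follow it, so the restriction
    never links the two sides of a step U. *)
Lemma is_restricted_cat_up p w :
  is_restricted (p ++ U :: w) = is_restricted p && is_restricted w.
Proof.
elim: p => [|s p IHp]; first by rewrite is_restricted_cons.
by rewrite cat_cons !is_restricted_cons IHp andbA; case: (p).
Qed.

Lemma is_restricted_flats m : is_restricted (nseq m H) = (m <= 1).
Proof. by case: m => [|[|m]]. Qed.

Lemma is_restricted_cat_down p n w :
  is_restricted ((p ++ nseq n H) ++ D :: w) =
  [&& n == 0, is_restricted (rcons p D) & is_restricted w].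
Proof.
rewrite -catA; elim: p => [|s p IHp] /=.
  case: n => [|n]; first by rewrite /= is_restricted_cons.
  by elim: n => //= n IHn; rewrite is_restricted_cons IHn andbF.
rewrite !is_restricted_cons IHp.
case: n {IHp} => [|n]; last by rewrite andbF.
by case: p => [|s' p] /=; rewrite ?andbT ?andbA.
Qed.

(** A stem is empty or ends with D, so a further D is allowed. *)
Lemma is_restricted_stem_down c :
  is_restricted (rcons (stem c) D) = is_restricted (stem c).
Proof.
case: c => // n q r; rewrite -cats1 /= -catA !cat_cons.
rewrite !is_restricted_cat_up -[(_ ++ [:: D]) ++ _]catA /=.
by rewrite !is_restricted_cat_down.
Qed.

Lemma is_restricted_stem_flats c m :
  is_restricted (stem c ++ nseq m H) = is_restricted (stem c) && (m <= 1).
Proof.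
case: c => [m'|n q r] /=; first exact: is_restricted_flats.
rewrite -catA !cat_cons !is_restricted_cat_up -[(_ ++ [:: D]) ++ _]catA /=.
by rewrite !is_restricted_cat_down is_restricted_flats !andbT !andbA.
Qed.

Lemma is_restricted_word c : is_restricted (word c) = thin c.
Proof.
elim: c => [m|n q IHq r IHr] /=; first exact: is_restricted_flats.
rewrite -IHq -IHr /word !is_restricted_stem_flats /=.
rewrite is_restricted_cat_up is_restricted_cat_down is_restricted_stem_down.
rewrite is_restricted_stem_flats andbT.
by case: (n == 0); rewrite /= ?andbF ?andbA.
Qed.

(** * The recursive structure of decorated trees *)

(** The value 1 at a leaf makes a leaf look like a tree that is already a
    legitimate child. *)
Definition root_label (t : tree) : nat := if t is Node l _ _ then l else 1.

Definition relabel (l : nat) (t : tree) : tree :=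
  if t is Node _ a ts then Node l a ts else Leaf.

(** Bare leaves stand for the constant term of the quadratic equation. *)
Definition leaf_or_T (t : tree) : bool := is_leaf t || in_T_inf_2 t.

Definition branch (t : tree) : bool := leaf_or_T t && (root_label t == 1).

Lemma only_outer_leaves2 t t' : only_outer_leaves [:: t; t'].
Proof. by case: t; case: t'. Qed.

Lemma only_outer_leaves_insert t0 x t1 ts :
  only_outer_leaves (t0 :: x :: t1 :: ts) =
  ~~ is_leaf x && only_outer_leaves (t0 :: t1 :: ts).
Proof.
rewrite /only_outer_leaves /= !implybT !eqSS implybF /= (iotaDl 1 2) all_map.
congr [&& _, _ & _]; apply: eq_in_all => i.
rewrite mem_iota /= => /andP[i_ge2 _].
by case: i i_ge2 => [|i].
Qed.

Lemma all_flatten_map (S T : Type) (p : pred T) (f : S -> seq T) s :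
  all p (flatten (map f s)) = all (fun x => all p (f x)) s.
Proof. by elim: s => //= x s IHs; rewrite all_cat IHs. Qed.

Lemma in_T_inf_2_root l a ts :
  in_T_inf_2 (Node l a ts) =
  [&& l <= 1, is_tree (Node l a ts), all (leq 1) (angle_labels (Node l a ts))
    & all (pred1 1) (flatten (map node_labels ts))].
Proof.
rewrite /in_T_inf_2.
have -> : all (fun i => (i == 0) || (i == 1)) (node_labels (Node l a ts)) =
    (l <= 1) && all (fun i => i <= 1) (flatten (map node_labels ts)).
  by congr (_ && _); [case: l => [|[]] | apply: eq_all => -[|[]]].
have ones_le1 s : all (leq^~ 1) s && all (pred1 1) s = all (pred1 1) s.
  by rewrite -all_predI; apply: eq_all => -[|[]].
rewrite /= -[X in _ = _ && (_ && (_ && X))]ones_le1.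
by case: (l <= 1); rewrite /= ?andbF.
Qed.

Lemma branchE t :
  branch t =
  [&& is_tree t, all (leq 1) (angle_labels t) & all (pred1 1) (node_labels t)].
Proof.
case: t => // l a ts; rewrite /branch /leaf_or_T in_T_inf_2_root.
by case: l => [|[|l]]; rewrite /= ?andbT ?andbF.
Qed.

(** The conditions on a tree bear on its root and, separately, on each child:
    the children are leaves or trees of root label 1. *)
Lemma in_T_inf_2_Node l a ts :
  in_T_inf_2 (Node l a ts) =
  [&& l <= 1, size ts == (size a).+1, 2 <= size ts, only_outer_leaves ts,
      all (leq 1) a & all branch ts].
Proof.
rewrite in_T_inf_2_root (eq_all branchE) !all_predI.
rewrite [is_tree _]/= [angle_labels _]/= all_cat !all_flatten_map -!andbA.
by do 4!congr (_ && _); rewrite andbCA.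
Qed.

(** * Joining two trees along an angle *)

(** One layer of [code], with trees in place of subcodes. *)
Inductive view : Type :=
| VFlat of nat
| VArch of nat & tree & tree.

Definition bare (m : nat) : tree :=
  if m is 0 then Leaf else Node 0 [:: m] [:: Leaf; Leaf].

(** When [q] and [r] are leaves or decorated trees, at least one of their root
    labels is 1 in the second case, so the product forgets nothing: a new root
    label 1 means that both labels were 1, and a label 0 comes from [q] if [q]
    is not a leaf, and from [r] otherwise. *)
Definition join (n : nat) (q r : tree) : tree :=
  match q, r with
  | Node l _ _, Node 0 a (t0 :: ts) =>
      Node l (n.+1 :: a) (t0 :: relabel 1 q :: ts)
  | _, _ =>
      Node (root_label q * root_label r) [:: n.+1] [:: relabel 1 q; relabel 1 r]
  end.

Definition build (v : view) : tree :=
  match v with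
  | VFlat m => bare m
  | VArch n q r => join n q r
  end.

(** A binary root of label 1 comes from two labels 1; one of label 0 took its 0
    from the left child, or from the right child when only the left one is a
    leaf.  With more children, the second child was
    inserted, and the root had label 0 before the insertion. *)
Definition split (t : tree) : view :=
  match t with
  | Node 0 (n :: _) [:: Leaf; Leaf] => VFlat n
  | Node 0 (n :: _) [:: Leaf; y] => VArch n.-1 Leaf (relabel 0 y)
  | Node l (n :: _) [:: x; y] => VArch n.-1 (relabel l x) y
  | Node l (n :: a) (t0 :: x :: ts) =>
      VArch n.-1 (relabel l x) (Node 0 a (t0 :: ts))
  | _ => VFlat 0
  end.

Lemma relabel_root_label t : relabel (root_label t) t = t.
Proof. by case: t. Qed.

Lemma branch_relabel t : leaf_or_T t -> branch (relabel 1 t).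
Proof.
case: t => //= l a ts; rewrite /branch /leaf_or_T /= !in_T_inf_2_Node andbT.
by case/andP.
Qed.

Lemma leaf_or_T_relabel l t : l <= 1 -> leaf_or_T t -> leaf_or_T (relabel l t).
Proof.
move=> l_le1; case: t => //= l' a ts.
rewrite /leaf_or_T /= !in_T_inf_2_Node l_le1.
by case/andP.
Qed.

Lemma root_label_le1 t : leaf_or_T t -> root_label t <= 1.
Proof.
by case: t => //= l a ts; rewrite /leaf_or_T in_T_inf_2_Node => /andP[].
Qed.

Lemma branch_root_label t : branch t -> root_label t = 1.
Proof. by case/andP => _ /eqP. Qed.

Lemma branch_leaf_or_T t : branch t -> leaf_or_T t.
Proof. by case/andP. Qed.

Lemma relabel_branch t : branch t -> relabel 1 t = t.
Proof. by move/branch_root_label => <-; apply: relabel_root_label. Qed.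

Lemma leaf_or_T_bare m : leaf_or_T (bare m).
Proof. by case: m. Qed.

Lemma leaf_or_T_join n q r :
  leaf_or_T q -> leaf_or_T r -> leaf_or_T (join n q r).
Proof.
move=> q_ok r_ok.
have binary_ok : leaf_or_T (Node (root_label q * root_label r) [:: n.+1]
    [:: relabel 1 q; relabel 1 r]).
  rewrite /leaf_or_T in_T_inf_2_Node only_outer_leaves2 /= !branch_relabel //.
  by rewrite -[1](muln1 1) leq_mul ?root_label_le1.
case: q r q_ok r_ok binary_ok => [|l a ts] [|[|l'] a' [|t0 [|t1 ts']]] //=.
  by rewrite /leaf_or_T !in_T_inf_2_Node /= andbF.
move=> q_ok; rewrite /leaf_or_T !in_T_inf_2_Node /= only_outer_leaves_insert /=.
rewrite !eqSS (root_label_le1 q_ok).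
rewrite (branch_relabel q_ok : branch (Node 1 a ts)).
by case/and5P => -> -> -> -> /andP[-> ->] _.
Qed.

Lemma split_bare m : split (bare m) = VFlat m.
Proof. by case: m. Qed.

Lemma split_join n q r :
  leaf_or_T q -> leaf_or_T r -> split (join n q r) = VArch n q r.
Proof.
case: q r => [|[|[|l]] a ts] [|[|[|l']] a' [|t0 [|t1 ts']]] //=;
  rewrite /leaf_or_T ?in_T_inf_2_Node //= ?andbF ?mul1n ?muln1 //=.
by case: (t0).
Qed.

(** The second child of a root with three or more children is not a leaf, so
    the insertion can be undone. *)
Lemma build_split t : leaf_or_T t -> build (split t) = t.
Proof.
case: t => [//|l [|n a] [|x [|y ts]]]; rewrite /leaf_or_T in_T_inf_2_Node
  //= ?andbF //.
case: ts => [|z ts].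
  case: a => [|? ?] //; last by rewrite !andbF.
  case: n => [|n]; first by rewrite !andbF.
  case/and5P => l_le1 _ _ _ /and3P[/relabel_branch<- /relabel_branch<- _].
  by case: l l_le1 => [|[|//]] _; case: x => [|lx ax tx];
    case: y => [|ly ay ty] /=; rewrite ?mul1n ?muln1.
rewrite only_outer_leaves_insert; case: n => [|n]; first by rewrite !andbF.
case/and5P => l_le1 _ /andP[y_node _] _ /and3P[_ /relabel_branch y1 _].
rewrite -y1; case: y y_node {y1} => //= ly ay ty _.
by case: l l_le1 => [|[|//]] _; case: x.
Qed.

Lemma leaf_or_T_split t :
  leaf_or_T t ->
  if split t is VArch _ q r then leaf_or_T q && leaf_or_T r else true.
Proof.
case: t => [//|l [|n a] [|x [|y ts]]]; rewrite /leaf_or_T in_T_inf_2_Node //=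
  ?andbF //.
case: ts => [|z ts].
  case/and5P => l_le1 _ _ _.
  case/and3P => /branch_leaf_or_T x_ok /branch_leaf_or_T y_ok _.
  have := leaf_or_T_relabel l_le1 x_ok.
  have := leaf_or_T_relabel (leq0n 1) y_ok.
  by case: l l_le1 => [|l] _; case: x x_ok => [|lx ax tx]; case: y y_ok => //=
    [|ly ay ty] y_ok x_ok ? ?; apply/andP; split.
rewrite only_outer_leaves_insert.
case/and5P => l_le1 sz /andP[_ outer] /andP[_ a_pos].
case/and3P => x_ok /branch_leaf_or_T y_ok /= zts_ok.
have rest_ok : leaf_or_T (Node 0 a [:: x, z & ts]).
  by rewrite /leaf_or_T in_T_inf_2_Node outer a_pos /= x_ok zts_ok !andbT.
have parts_ok : leaf_or_T (relabel l y) && leaf_or_T (Node 0 a [:: x, z & ts]).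
  by rewrite leaf_or_T_relabel.
by move: parts_ok; case: (l) => //; case: (x) => //; case: (y).
Qed.

(** * Degrees and angle labels under joining *)

Lemma angle_labels_relabel l t : angle_labels (relabel l t) = angle_labels t.
Proof. by case: t. Qed.

Lemma perm_angle_labels_join n q r :
  perm_eq (angle_labels (join n q r))
          (n.+1 :: angle_labels q ++ angle_labels r).
Proof.
have binary : perm_eq (angle_labels (Node (root_label q * root_label r)
    [:: n.+1] [:: relabel 1 q; relabel 1 r]))
    (n.+1 :: angle_labels q ++ angle_labels r).
  by rewrite /= !angle_labels_relabel cats0.
case: q r binary => [|l a ts] [|[|l'] a' [|t0 ts']] //= _.
rewrite perm_cons [X in perm_eq X _]catA [X in perm_eq _ (_ ++ X)]catA.
by rewrite perm_catCA.
Qed.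

Lemma deg_node_relabel t :
  deg_node (relabel 1 t) + root_label t = (deg_node t).+1.
Proof. by case: t => //= l a ts; rewrite /deg_node /=; lia. Qed.

(** An insertion relabels the child to 1 but moves its old label to the new
    root, so it adds one.  Under a new binary root, relabelling the children,
    with old labels l and l' not both 0, adds (1 - l) + (1 - l'), the new root
    adds l l', and l l' + (1 - l) + (1 - l') = 1 + (1 - l) (1 - l') = 1. *)
Lemma deg_node_join n q r :
  leaf_or_T q -> leaf_or_T r ->
  deg_node (join n q r) = (deg_node q + deg_node r).+1.
Proof.
move=> q_ok r_ok.
have binary : (root_label q == 1) || (root_label r == 1) ->
    deg_node (Node (root_label q * root_label r) [:: n.+1]
      [:: relabel 1 q; relabel 1 r]) = (deg_node q + deg_node r).+1.
  move=> one_label; rewrite /deg_node /= cats0 sumn_cat -!/(deg_node _).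
  have := (deg_node_relabel q, deg_node_relabel r).
  have := (root_label_le1 q_ok, root_label_le1 r_ok).
  by case/orP: one_label => /eqP -> [] ? ? []; rewrite ?mul1n ?muln1; lia.
case: q q_ok binary => [|l a ts] q_ok; first by move=> ->.
case: r r_ok => [|[|l'] a' ts'] r_ok; first by move=> ->; rewrite ?orbT.
  case: ts' r_ok => [|t0 ts'] r_ok _.
    by move: r_ok; rewrite /leaf_or_T in_T_inf_2_Node.
  by rewrite /deg_node /= !(sumn_cat, flatten_cat) /= sumn_cat; lia.
move=> -> //; move: r_ok; rewrite /leaf_or_T in_T_inf_2_Node.
by case: l' => [|//]; rewrite orbT.
Qed.

Definition degree (t : tree) : nat := deg_angle t + deg_node t.

Lemma degree_join n q r :
  leaf_or_T q -> leaf_or_T r ->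
  degree (join n q r) = n + 2 + degree q + degree r.
Proof.
move=> q_ok r_ok; rewrite /degree deg_node_join // /deg_angle.
by rewrite (perm_sumn (perm_angle_labels_join n q r)) /= sumn_cat; lia.
Qed.

(** * Decorated trees and codes *)

Fixpoint tree_of_code (c : code) : tree :=
  match c with
  | Flat m => bare m
  | Arch n q r => join n (tree_of_code q) (tree_of_code r)
  end.

Lemma leaf_or_T_tree_of_code c : leaf_or_T (tree_of_code c).
Proof.
by elim: c => /= *; [apply: leaf_or_T_bare | apply: leaf_or_T_join].
Qed.

Lemma tree_of_code_inj : injective tree_of_code.
Proof.
elim=> [m|n q IHq r IHr] [m'|n' q' r'] /= /(congr1 split);
  rewrite ?split_bare ?split_join ?leaf_or_T_tree_of_code //.
  by case=> ->.
by case=> -> /IHq -> /IHr ->.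
Qed.

Lemma tree_of_code_onto t : leaf_or_T t -> {c | tree_of_code c = t}.
Proof.
have [d] := ubnP (degree t); elim: d t => // d IHd t lt_d t_ok.
have := build_split t_ok; have := leaf_or_T_split t_ok.
case: (split t) => [m _ <-|n q r /andP[q_ok r_ok] /= t_def].
  by exists (Flat m).
move: lt_d; rewrite -t_def degree_join // => lt_d.
have [|cq cq_def] := IHd q _ q_ok; first by lia.
have [|cr cr_def] := IHd r _ r_ok; first by lia.
by exists (Arch n cq cr); rewrite /= cq_def cr_def.
Qed.

Lemma degree_tree_of_code c : degree (tree_of_code c) = code_size c.
Proof.
elim: c => [[|m] // | n q IHq r IHr] /=.
  by rewrite /degree /deg_angle /deg_node /= !addn0.
by rewrite degree_join ?leaf_or_T_tree_of_code // IHq IHr.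
Qed.

Lemma unit_angles_tree_of_code c :
  all (fun n => n == 1) (angle_labels (tree_of_code c)) = thin c.
Proof.
elim: c => [[|[|m]] // | n q IHq r IHr] /=.
by rewrite (perm_all _ (perm_angle_labels_join _ _ _)) /= all_cat IHq IHr.
Qed.

Lemma in_T_inf_2_pos_degree t : 0 < degree t -> in_T_inf_2 t = leaf_or_T t.
Proof. by case: t. Qed.

(** * The bijections *)

Theorem proposition3p5 (k : nat) (hk : 1 <= k) :
  (exists f : T_inf_2 k -> MP k, bijective f) /\
  (exists g : T_2_2 k -> RMP k, bijective g).
Proof.
have T_MP c : in_T_inf_2 (tree_of_code c) && (degree (tree_of_code c) == k) =
    is_motzkin k (word c).
  rewrite is_motzkinE motzkin_word size_word andbT -degree_tree_of_code.
  rewrite andbC; case: eqP => // deg_k.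
  by rewrite in_T_inf_2_pos_degree ?deg_k // leaf_or_T_tree_of_code.
split; apply: (sub_bijective_of_common_code tree_of_code_inj (can_inj wordK)).
- move=> t /andP[t_ok _]; apply: tree_of_code_onto.
  by rewrite /leaf_or_T t_ok orbT.
- by move=> p; rewrite is_motzkinE => /andP[_ /word_onto].
- exact: T_MP.
- move=> t /andP[/andP[t_ok _] _]; apply: tree_of_code_onto.
  by rewrite /leaf_or_T t_ok orbT.
- by move=> p; rewrite is_motzkinE => /andP[/andP[_ /word_onto]].
move=> c; rewrite is_restricted_word -T_MP /in_T_2_2 unit_angles_tree_of_code.
by rewrite andbAC.
Qed.
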